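(* The sequence spaces $cs^{\lambda}$, $cs_0^{\lambda}$ and $bs^{\lambda}$ are BK-spaces with the same norm $\|x\|_{cs^{\lambda}}=\|x\|_{cs_0^{\lambda}}=\|x\|_{bs^{\lambda}}$, that is, $$\|x\|_{bs^{\lambda}}=\|\Lambda(x)\|_{bs}=\sup_{m}\left|\sum_{n=0}^{m}\Lambda_{n}(x)\right|<\infty .$$
   Context: $\mathbb{N}=\{0,1,2,\dots\}$ and $w=\mathbb{C}^{\mathbb{N}}$ is the space of all complex sequences. A sequence space is a linear subspace of $w$. A sequence space $E$ with a linear topology is a K-space if each coordinate map $p_i:E\to\mathbb{C}$, $p_i(x)=x_i$, is continuous. A K-space that is a complete linear metric space is an FK-space. The paper's definition of BK-space reads: an FK-space whose topology is normable is called a BK-space which contains $\phi$, the set of all finitely non-zero sequences. $\lambda=(\lambda_k)_{k\in\mathbb{N}}$ is a fixed strictly increasing sequence of positive reals tending to infinity, with the convention $\lambda_{-1}=0$. For $x=(x_k)\in w$ put $\Lambda(x)=(\Lambda_n(x))_{n\in\mathbb{N}}$, $\Lambda_n(x)=\frac{1}{\lambda_n}\sum_{k=0}^{n}(\lambda_k-\lambda_{k-1})x_k$. $cs$, $cs_0$, $bs$ are the spaces of sequences $x\in w$ whose sequence of partial sums $\left(\sum_{n=0}^m x_n\right)_m$ is, respectively, convergent, convergent to $0$, bounded; each is normed by $\|x\|_{bs}=\sup_m\left|\sum_{n=0}^m x_n\right|$. Define $cs^{\lambda}=\{x\in w:\Lambda(x)\in cs\}$, $cs_0^{\lambda}=\{x\in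 w:\Lambda(x)\in cs_0\}$, $bs^{\lambda}=\{x\in w:\Lambda(x)\in bs\}$.
   Formalization: BK-space is taken as an FK-space with normable topology, without requiring that it contain φ: the sequence (1,0,0,…) is never in cs_0^λ, since all partial sums of its Λ-transform are at least 1, so the claim with φ required is false. *)

(* Defs.v *)
From HB Require Import structures.
From mathcomp Require Import all_boot all_order all_algebra.
From mathcomp Require Import all_classical all_reals all_analysis.
From mathcomp Require Import complex.

Set Implicit Arguments.
Unset Strict Implicit.
Unset Printing Implicit Defensive.

Import Order.TTheory GRing.Theory Num.Theory.
Import numFieldNormedType.Exports.
Import ComplexField.Normc.

Local Open Scope classical_set_scope.
Local Open Scope ring_scope.
Local Open Scope complex_scope.

(* The usual topology of the complex plane: the library attaches the topology
   given by the modulus to abstract numeric fields, but not to R[i] itself. *)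
HB.instance Definition _ (R : rcfType) := NormedModule.copy R[i] R[i]^o.

Section TopologicalSequenceSpaces.
Context {R : realType}.

(* A sequence space E with a linear topology is given by a topological vector
   space V over R[i] together with a linear bijection j from V onto E; the
   topology of E is that of V transported along j. Being the image of j, E is
   a linear subspace of the space nat -> R[i] of all sequences. *)
Definition K_space (E : set (nat -> R[i])) (V : topologicalLmodType R[i])
    (j : {linear V -> (nat -> R[i])}) : Prop :=
  [/\ injective j, range j = E & forall i : nat, continuous (fun v => j v i)].

Definition is_metric (V : Type) (d : V -> V -> R) : Prop :=
  [/\ forall x y, 0 <= d x y,
      forall x y, d x y = 0 <-> x = y,
      forall x y, d x y = d y x &
      forall x y z, d x z <= d x y + d y z].

Definition translation_invariant (V : zmodType) (d : V -> V -> R) : Prop :=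
  forall x y z, d (x + z) (y + z) = d x y.

Definition metrizes (V : topologicalType) (d : V -> V -> R) : Prop :=
  forall (x : V) (A : set V),
    nbhs x A <-> exists2 e : R, 0 < e & [set y | d x y < e] `<=` A.

Definition metric_complete (V : topologicalType) (d : V -> V -> R) : Prop :=
  forall u : nat -> V,
    (forall e : R, 0 < e -> exists N : nat, forall m n : nat,
       (N <= m)%N -> (N <= n)%N -> d (u m) (u n) < e) ->
    exists l : V, u @ \oo --> l.

Definition FK_space (E : set (nat -> R[i])) (V : topologicalLmodType R[i])
    (j : {linear V -> (nat -> R[i])}) : Prop :=
  K_space E j /\
  exists d : V -> V -> R,
    [/\ is_metric d, translation_invariant d, metrizes d & metric_complete d].

(* E is a BK-space with norm N: some normed space structure on E whose norm is
   N (in particular N is finite on E) makes E an FK-space. The norm of a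
   normedModType over R[i] is R[i]-valued, whence the embedding _%:C.
   E is not required to contain the finitely non-zero sequences: cs0_lambda lam
   below never contains (1, 0, 0, ...), and cs_lambda lam and bs_lambda lam do
   not when the sum of the 1 / lam n diverges. *)
Definition BK_space_with_norm (E : set (nat -> R[i]))
    (N : (nat -> R[i]) -> \bar R) : Prop :=
  exists (V : normedModType R[i]) (j : {linear V -> (nat -> R[i])}),
    FK_space E j /\
    forall v : V, (N (j v) < +oo)%E /\ `|v| = (fine (N (j v)))%:C.

End TopologicalSequenceSpaces.

Section LambdaSpaces.
Context {R : realType}.
Implicit Types (lam : nat -> R) (x : nat -> R[i]).

Definition partial_sum x (m : nat) : R[i] := \sum_(n < m.+1) x n.

Definition cs : set (nat -> R[i]) := [set x | cvgn (partial_sum x)].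

Definition cs0 : set (nat -> R[i]) :=
  [set x | partial_sum x @ \oo --> (0 : R[i])].

Definition bs : set (nat -> R[i]) := [set x | bounded_fun (partial_sum x)].

Definition bs_norm x : \bar R :=
  ereal_sup (range (fun m : nat => (normc (partial_sum x m))%:E)).

(* lam_(k-1), with lam_(-1) = 0. *)
Definition lam_pred lam (k : nat) : R := if k is k'.+1 then lam k' else 0.

Definition Lambda lam x (n : nat) : R[i] :=
  ((lam n)^-1)%:C * \sum_(k < n.+1) (lam k - lam_pred lam k)%:C * x k.

Definition cs_lambda lam : set (nat -> R[i]) := [set x | cs (Lambda lam x)].

Definition cs0_lambda lam : set (nat -> R[i]) := [set x | cs0 (Lambda lam x)].

Definition bs_lambda lam : set (nat -> R[i]) := [set x | bs (Lambda lam x)].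

Definition bs_lambda_norm lam x : \bar R := bs_norm (Lambda lam x).

End LambdaSpaces.

(* Main.v *)
(* Put S x m = sum_(n <= m) Lambda_n x, so that the norm is sup_m |S x m|. Taking
   differences twice, first of the S x m and then of the lam_n * Lambda_n x,
   bounds each |x i| by C_i * ||x||. Hence coordinates are continuous, the
   seminorm is a norm, and the terms of a Cauchy sequence converge coordinatewise
   to some x. As S x m depends on finitely many coordinates, the
   S (u n) m converge to S x m for each m, hence uniformly in m by the Cauchy
   condition; boundedness, convergence and convergence to 0 all pass to uniform
   limits. *)
Require Import Defs.
From HB Require Import structures.
From mathcomp Require Import all_boot all_order all_algebra.
From mathcomp Require Import all_classical all_reals all_analysis.
From mathcomp Require Import complex.

Import Order.TTheory GRing.Theory Num.Theory.
Import numFieldNormedType.Exports.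

Local Open Scope classical_set_scope.
Local Open Scope ring_scope.

(** * Epsilon calculus in complex normed spaces with a real-valued norm *)

Section RealNorm.
Context {R : realType} {V : normedModType R[i]}.
Implicit Types v w : V.

(* The norm of V takes its values in the nonnegative reals of R[i]. *)
Definition rnorm v : R := complex.Re `|v|.

Lemma norm_rnorm v : `|v| = (rnorm v)%:C%C.
Proof. by rewrite RRe_real ?normr_real. Qed.

Lemma rnorm_ge0 v : 0 <= rnorm v.
Proof. by rewrite -lecR -norm_rnorm normr_ge0. Qed.

Lemma rnorm0 : rnorm 0 = 0.
Proof. by rewrite /rnorm normr0. Qed.

Lemma rnorm0_eq0 v : rnorm v = 0 -> v = 0.
Proof. by move=> v0; apply/eqP; rewrite -normr_eq0 norm_rnorm v0. Qed.

Lemma rnormN v : rnorm (- v) = rnorm v.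
Proof. by rewrite /rnorm normrN. Qed.

Lemma rnorm_distC v w : rnorm (v - w) = rnorm (w - v).
Proof. by rewrite /rnorm distrC. Qed.

Lemma ler_rnormD v w : rnorm (v + w) <= rnorm v + rnorm w.
Proof. by rewrite -lecR rmorphD /= -!norm_rnorm ler_normD. Qed.

Lemma ler_rnorm_dist u v w : rnorm (v - w) <= rnorm (v - u) + rnorm (u - w).
Proof. by rewrite (le_trans _ (ler_rnormD _ _))// addrA subrK. Qed.

Lemma nbhs_rnormP (v : V) (A : set V) :
  nbhs v A <-> exists2 e : R, 0 < e & [set w | rnorm (v - w) < e] `<=` A.
Proof.
split=> [/nbhs_normP[e /= e0 eA]|[e e0 eA]].
  (* A positive element of [R[i]] is real, because the order only relates numbers with equal
     imaginary parts. *)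
  have eE : e = (complex.Re e)%:C%C by rewrite RRe_real// gtr0_real.
  exists (complex.Re e); first by rewrite -ltcR -eE.
  by move=> w /= vw; apply: eA; rewrite /= norm_rnorm eE ltcR.
apply/nbhs_normP; exists (e%:C)%C; first by rewrite /= ltcR.
by move=> w; rewrite /= norm_rnorm ltcR => /eA.
Qed.

Lemma cvg_rnormP (u : nat -> V) (l : V) : u @ \oo --> l <->
  forall e : R, 0 < e ->
    exists N, forall n, (N <= n)%N -> rnorm (l - u n) < e.
Proof.
split=> [ul e e0|ul A].
  have [N _ NP] : (u @ \oo) [set w | rnorm (l - w) < e].
    by apply: ul; apply/nbhs_rnormP; exists e.
  by exists N => n Nn; apply: NP.
move=> /nbhs_rnormP[e e0 eA]; have [N NP] := ul e e0.
by exists N => // n /= Nn; apply: eA; exact: NP.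
Qed.

Definition rnorm_cauchy (u : nat -> V) := forall e : R, 0 < e ->
  exists N, forall m n, (N <= m)%N -> (N <= n)%N -> rnorm (u m - u n) < e.

Lemma cvg_rnorm_cauchy (u : nat -> V) (l : V) : u @ \oo --> l -> rnorm_cauchy u.
Proof.
move=> /cvg_rnormP ul e e0; have [|N NP] := ul (e / 2); first exact: divr_gt0.
exists N => m n Nm Nn; apply: le_lt_trans (ler_rnorm_dist l _ _) _.
by rewrite (splitr e) rnorm_distC ltrD ?NP.
Qed.

(** The distance [rnorm (v - w)] is an invariant metric inducing the topology, so only the K-space
    conditions and sequential completeness remain to be checked. *)
Lemma FK_space_rnorm (E : set (nat -> R[i])) (j : {linear V -> (nat -> R[i])}) :
  K_space E j ->
  (forall u : nat -> V, rnorm_cauchy u -> exists l : V, u @ \oo --> l) ->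
  FK_space E j.
Proof.
move=> KE Vcomplete; split=> //; exists (fun v w => rnorm (v - w)); split.
- split; [by move=> v w; exact: rnorm_ge0| |exact: rnorm_distC|].
    move=> v w; split=> [/rnorm0_eq0/eqP|->]; last by rewrite subrr rnorm0.
    by rewrite subr_eq0 => /eqP.
  by move=> v w z; exact: ler_rnorm_dist.
- by move=> v w z; rewrite opprD addrACA subrr addr0.
- exact: nbhs_rnormP.
- exact: Vcomplete.
Qed.

End RealNorm.

(** * Completeness of the complex plane *)

Section ComplexComplete.
Context {R : realType}.
Implicit Types (z w : R[i]) (u : nat -> R[i]).

Lemma rnormM z w : rnorm (z * w) = rnorm z * rnorm w.
Proof. exact: ComplexField.Normc.normcM. Qed.

Lemma Re_le_rnorm z : `|complex.Re z| <= rnorm z.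
Proof. by rewrite -lecR -norm_rnorm normc_ge_Re. Qed.

Lemma Im_le_rnorm z : `|complex.Im z| <= rnorm z.
Proof.
case: z => a b /=; rewrite -[X in X <= _]sqrtr_sqr.
by apply: ler_wsqrtr; rewrite lerDr sqr_ge0.
Qed.

Lemma rnorm_le_ReIm z : rnorm z <= `|complex.Re z| + `|complex.Im z|.
Proof.
case: z => a b; rewrite (_ : Complex a b = Complex a 0 + Complex 0 b); last first.
  by apply/eqP; rewrite eq_complex /= addr0 add0r !eqxx.
by rewrite (le_trans (ler_rnormD _ _))// /rnorm /= expr0n /= !addr0 !add0r !sqrtr_sqr.
Qed.

Lemma real_cauchy_cvg (x : nat -> R) :
  (forall e, 0 < e -> exists N, forall m n,
     (N <= m)%N -> (N <= n)%N -> `|x m - x n| < e) ->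
  exists l : R, x @ \oo --> l.
Proof.
move=> xC; suff /cauchy_cvgP : cauchy (x @ \oo) by exists (lim (x @ \oo)).
apply: cauchy_exP => e e0; have [N NP] := xC e e0.
by exists (x N), N => // n /= Nn; exact: NP.
Qed.

(** Real and imaginary parts are dominated by the modulus, hence Cauchy in [R]; their limits are the
    two parts of [l]. *)
Lemma complex_complete u : rnorm_cauchy u -> exists l : R[i], u @ \oo --> l.
Proof.
move=> uC.
have [e e0|a ua] := @real_cauchy_cvg (fun n => complex.Re (u n)).
  have [N NP] := uC e e0; exists N => m n Nm Nn.
  by rewrite -raddfB (le_lt_trans (Re_le_rnorm _))// NP.
have [e e0|b ub] := @real_cauchy_cvg (fun n => complex.Im (u n)).
  have [N NP] := uC e e0; exists N => m n Nm Nn.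
  by rewrite -raddfB (le_lt_trans (Im_le_rnorm _))// NP.
exists (Complex a b); apply/cvg_rnormP => e e0.
have e2 : 0 < e / 2 by rewrite divr_gt0.
have /cvgrPdist_lt/(_ _ e2)[N _ NP] := ua.
have /cvgrPdist_lt/(_ _ e2)[M _ MP] := ub.
exists (maxn N M) => n; rewrite geq_max => /andP[Nn Mn].
apply: le_lt_trans (rnorm_le_ReIm _) _; rewrite !raddfB (splitr e).
by apply: ltrD; [exact: NP|exact: MP].
Qed.

End ComplexComplete.

(** * Normed spaces carried by a set of sequences *)

Record normed_seqspace (R : realType) := NormedSeqspace {
  seqspace_set : set (nat -> R[i]);
  seqspace_norm : (nat -> R[i]) -> R;
  seqspace_submod : submod_closed [pred x | x \in seqspace_set];
  seqspace_normD : forall x y, x \in seqspace_set -> y \in seqspace_set ->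
    seqspace_norm (x + y) <= seqspace_norm x + seqspace_norm y;
  seqspace_normZ : forall a x, x \in seqspace_set ->
    seqspace_norm (a *: x) = rnorm a * seqspace_norm x;
  seqspace_norm0_eq0 : forall x, x \in seqspace_set ->
    seqspace_norm x = 0 -> x = 0 }.

Arguments seqspace_set {R}.
Arguments seqspace_norm {R}.
Arguments seqspace_submod {R}.
Arguments seqspace_normD {R}.
Arguments seqspace_normZ {R}.
Arguments seqspace_norm0_eq0 {R}.

Section NormedSeqspaceType.
Context {R : realType} (X : normed_seqspace R).

Definition seqspace_pred : {pred (nat -> R[i])} :=
  [pred x | x \in seqspace_set X].

HB.instance Definition _ :=
  GRing.isSubmodClosed.Build R[i] (nat -> R[i]) seqspace_pred
    (seqspace_submod X).

(** Since [X] bundles the carrier, the norm and their axioms, the instances below are declared once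
    for all the spaces. *)
Definition seqspace := {x | x \in seqspace_pred}.

HB.instance Definition _ := SubType.on seqspace.
HB.instance Definition _ := Choice.on seqspace.
HB.instance Definition _ := [SubChoice_isSubLmodule of seqspace by <:].

Let norm (v : seqspace) : R[i] := (seqspace_norm X (val v))%:C%C.

Let normD v w : norm (v + w) <= norm v + norm w.
Proof.
by rewrite -rmorphD lecR raddfD; apply: (seqspace_normD X); exact: valP.
Qed.

Let normZ a v : norm (a *: v) = `|a| * norm v.
Proof.
by rewrite /norm linearZ seqspace_normZ ?rmorphM -?norm_rnorm//; exact: valP.
Qed.

Let norm0_eq0 v : norm v = 0 -> v = 0.
Proof.
move=> [] /(seqspace_norm0_eq0 X) v0; apply/val_inj; rewrite raddf0; apply: v0.
exact: valP.
Qed.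

HB.instance Definition _ :=
  Lmodule_isNormed.Build R[i] seqspace normD normZ norm0_eq0.

Lemma seqspace_rnormE (v : seqspace) : rnorm v = seqspace_norm X (val v).
Proof. by []. Qed.

Definition seqspace_embed (v : seqspace) : nat -> R[i] := val v.

HB.instance Definition _ := GRing.Linear.copy seqspace_embed (\val : seqspace -> _).

End NormedSeqspaceType.

(** The bound on [x i], applied to differences, makes each coordinate Lipschitz, hence continuous;
    injectivity and range are clear since the embedding is the inclusion. *)
Lemma BK_space_normed_seqspace (R : realType) (X : normed_seqspace R)
    (N : (nat -> R[i]) -> \bar R) :
  (forall x, x \in seqspace_set X -> N x = (seqspace_norm X x)%:E) ->
  (forall i, exists C, forall x, x \in seqspace_set X ->
     rnorm (x i) <= C * seqspace_norm X x) ->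
  (forall u : nat -> seqspace X, rnorm_cauchy u ->
     exists l : seqspace X, u @ \oo --> l) ->
  BK_space_with_norm (seqspace_set X) N.
Proof.
move=> NE Xcoord Xcomplete.
pose j : {linear seqspace X -> (nat -> R[i])} := seqspace_embed X.
exists (seqspace X : normedModType R[i]), j; split; last first.
  by move=> v; rewrite NE ?ltry//; exact: valP.
apply: FK_space_rnorm => //; split; first exact: val_inj.
  apply/seteqP; split=> [_ [v _ <-]|x Xx]; first exact/set_mem/(valP v).
  by exists (exist _ x (mem_set Xx)).
move=> i v A /nbhs_rnormP[e e0 eA].
have [C XC] := Xcoord i.
(* The sign of [C] is unknown; [|C| + 1] is positive and dominates it. *)
apply/nbhs_rnormP; exists (e / (`|C| + 1)); first by rewrite divr_gt0// ltr_wpDl.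
move=> w /=; rewrite ltr_pdivlMr ?ltr_wpDl// => vw; apply: eA => /=.
have -> : j v i - j w i = val (v - w) i by rewrite raddfB.
apply: le_lt_trans (XC _ (valP (v - w))) _.
apply: le_lt_trans vw.
rewrite mulrC seqspace_rnormE ler_wpM2l ?rnorm_ge0//.
  exact: (rnorm_ge0 (v - w)).
by rewrite (le_trans (ler_norm _))// lerDl.
Qed.

(** * Partial sums of [Lambda] and the norm they define *)

Section LambdaNorm.
Context {R : realType} (lam : nat -> R).
Implicit Types (x y : nat -> R[i]) (a : R[i]).

Lemma Lambda_linear a x y n :
  Lambda lam (a *: x + y) n = a * Lambda lam x n + Lambda lam y n.
Proof.
rewrite /Lambda [a * _]mulrCA -mulrDr; congr (_ * _).
rewrite mulr_sumr -big_split /=.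
by apply: eq_bigr => k _; rewrite [a * _]mulrCA -mulrDr.
Qed.

Definition Lambda_sum x m : R[i] := partial_sum (Lambda lam x) m.

Lemma Lambda_sum_linear a x y m :
  Lambda_sum (a *: x + y) m = a * Lambda_sum x m + Lambda_sum y m.
Proof.
rewrite /Lambda_sum /partial_sum mulr_sumr -big_split /=.
by apply: eq_bigr => k _; exact: Lambda_linear.
Qed.

Lemma Lambda_sum0 m : Lambda_sum 0 m = 0.
Proof.
by have := Lambda_sum_linear (-1) 0 0 m; rewrite scaler0 addr0 mulN1r addNr.
Qed.

Lemma Lambda_sumZ a x m : Lambda_sum (a *: x) m = a * Lambda_sum x m.
Proof. by rewrite -[a *: x]addr0 Lambda_sum_linear Lambda_sum0 addr0. Qed.

Lemma Lambda_sumD x y m : Lambda_sum (x + y) m = Lambda_sum x m + Lambda_sum y m.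
Proof. by rewrite -[x]scale1r Lambda_sum_linear scale1r mul1r. Qed.

Lemma Lambda_sumB x y m : Lambda_sum (x - y) m = Lambda_sum x m - Lambda_sum y m.
Proof. by rewrite Lambda_sumD -scaleN1r Lambda_sumZ mulN1r. Qed.

(** A partial sum is a finite linear combination of coordinates, hence continuous for coordinatewise
    convergence. *)
Lemma Lambda_sum_cvg (u : nat -> nat -> R[i]) x m :
  (forall i, u ^~ i @ \oo --> x i) -> Lambda_sum (u n) m @[n --> \oo] --> Lambda_sum x m.
Proof.
move=> ux; rewrite /Lambda_sum /partial_sum.
apply: cvg_big => [|n _]; first exact: add_continuous.
apply: cvgZr; apply: cvg_big => [|k _]; first exact: add_continuous.
exact: cvgZr.
Qed.

Lemma bs_lambdaP x :
  bs_lambda lam x <-> exists C : R, forall m, rnorm (Lambda_sum x m) <= C.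
Proof.
have PF : ProperFilter (globally [set: nat]) by exact: (@globally_properfilter _ _ 0%N).
split=> [/ex_bound[M xM]|[C xC]].
  exists (complex.Re M) => m; have := xM m I => /=.
  by rewrite lecE => /andP[_].
by apply/ex_bound; exists (C%:C)%C => m _ /=; rewrite norm_rnorm lecR; exact: xC.
Qed.

(** [fine] sends an infinite supremum to 0, so this is the intended norm only on [bs_lambda lam]. *)
Definition lnorm x : R := fine (bs_lambda_norm lam x).

Lemma bs_lambda_normE x : bs_lambda lam x -> bs_lambda_norm lam x = (lnorm x)%:E.
Proof.
move=> /bs_lambdaP[C xC]; rewrite /lnorm fineK// fin_numElt; apply/andP; split.
  (* The term of index 0 keeps the supremum away from minus infinity. *)
  apply: (@lt_le_trans _ _ (rnorm (Lambda_sum x 0))%:E); first exact: ltNyr.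
  by apply: ereal_sup_ubound; exists 0%N.
apply: (@le_lt_trans _ _ C%:E); last exact: ltry.
by apply: ge_ereal_sup => _ [m _ <-]; rewrite lee_fin; exact: xC.
Qed.

Lemma Lambda_sum_le x m : bs_lambda lam x -> rnorm (Lambda_sum x m) <= lnorm x.
Proof.
move=> bx; rewrite -lee_fin -bs_lambda_normE//.
by apply: ereal_sup_ubound; exists m.
Qed.

Lemma lnorm_le x (C : R) : (forall m, rnorm (Lambda_sum x m) <= C) -> lnorm x <= C.
Proof.
move=> xC; have bx : bs_lambda lam x by apply/bs_lambdaP; exists C.
rewrite -lee_fin -bs_lambda_normE//.
by apply: ge_ereal_sup => _ [m _ <-]; rewrite lee_fin; exact: xC.
Qed.

Lemma lnorm_ge0 x : bs_lambda lam x -> 0 <= lnorm x.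
Proof. by move=> bx; rewrite (le_trans _ (Lambda_sum_le x 0 bx))// rnorm_ge0. Qed.

Lemma bs_lambda_submod : submod_closed [pred x | x \in bs_lambda lam].
Proof.
split; first by rewrite inE; apply/bs_lambdaP; exists 0 => m; rewrite Lambda_sum0 rnorm0.
move=> a x y /=; rewrite !inE => bx by_; apply/bs_lambdaP.
exists (rnorm a * lnorm x + lnorm y) => m.
rewrite Lambda_sum_linear (le_trans (ler_rnormD _ _))// rnormM.
by rewrite lerD ?ler_wpM2l ?rnorm_ge0 ?Lambda_sum_le.
Qed.

Lemma lnormD x y : bs_lambda lam x -> bs_lambda lam y ->
  lnorm (x + y) <= lnorm x + lnorm y.
Proof.
move=> bx by_; apply: lnorm_le => m; rewrite Lambda_sumD.
by rewrite (le_trans (ler_rnormD _ _))// lerD ?Lambda_sum_le.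
Qed.

(** For nonzero [a], the reverse inequality is the direct one for the scalar [a^-1] and the sequence
    [a *: x]. *)
Lemma lnormZ a x : bs_lambda lam x -> lnorm (a *: x) = rnorm a * lnorm x.
Proof.
have lnormZ_le b y : bs_lambda lam y -> lnorm (b *: y) <= rnorm b * lnorm y.
  move=> by_; apply: lnorm_le => m; rewrite Lambda_sumZ rnormM.
  by rewrite ler_wpM2l ?rnorm_ge0 ?Lambda_sum_le.
move=> bx; apply/eqP; rewrite eq_le lnormZ_le//=.
have bax : bs_lambda lam (a *: x).
  apply/bs_lambdaP; exists (rnorm a * lnorm x) => m.
  by rewrite Lambda_sumZ rnormM ler_wpM2l ?rnorm_ge0 ?Lambda_sum_le.
have [a0|a0] := eqVneq a 0.
  by rewrite [in leLHS]a0 rnorm0 mul0r lnorm_ge0.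
have a_gt0 : 0 < rnorm a.
  by rewrite lt_neqAle rnorm_ge0 andbT eq_sym; apply: contra_neq a0 => /rnorm0_eq0.
rewrite mulrC -ler_pdivlMr// mulrC.
rewrite -[in leLHS](scalerK a0 x) (le_trans (lnormZ_le _ _ bax))//.
rewrite ler_wpM2r ?lnorm_ge0// -(ler_pM2r a_gt0) -rnormM !mulVf// ?gt_eqF//.
by rewrite /rnorm normr1.
Qed.

(** * Functionals bounded by the norm, the coordinates among them *)

Definition lnorm_bounded (f : (nat -> R[i]) -> R[i]) :=
  exists C, forall x, bs_lambda lam x -> rnorm (f x) <= C * lnorm x.

Lemma lnorm_boundedZ (c : R[i]) f :
  lnorm_bounded f -> lnorm_bounded (fun x => c * f x).
Proof.
move=> [C fC]; exists (rnorm c * C) => x bx.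
by rewrite rnormM -mulrA ler_wpM2l ?rnorm_ge0 ?fC.
Qed.

(** A summand is the difference of two consecutive sums, so the two constants add up. *)
Lemma lnorm_bounded_summand (g : nat -> (nat -> R[i]) -> R[i]) :
  (forall n, lnorm_bounded (fun x => \sum_(k < n.+1) g k x)) ->
  forall n, lnorm_bounded (g n).
Proof.
move=> sumg n; have [C nC] := sumg n.
have [C' nC'] : lnorm_bounded (fun x => \sum_(k < n) g k x).
  (* For [n = 0] the shorter sum is empty, a case that [sumg] does not cover. *)
  case: n {nC} => [|n]; last exact: sumg.
  by exists 0 => x _; rewrite big_ord0 mul0r rnorm0.
exists (C + C') => x bx.
have -> : g n x = \sum_(k < n.+1) g k x - \sum_(k < n) g k x.
  by rewrite big_ord_recr /= [X in X - _]addrC addrK.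
rewrite (le_trans (ler_rnormD _ _))// rnormN mulrDl.
by rewrite lerD ?nC ?nC'.
Qed.

Hypothesis lam_gt0 : forall k, 0 < lam k.
Hypothesis lam_incr : forall m n, (m < n)%N -> lam m < lam n.

Lemma lam_diff_gt0 k : 0 < lam k - lam_pred lam k.
Proof. by case: k => [|k] /=; rewrite ?subr0 ?subr_gt0 ?lam_incr. Qed.

Lemma coord_lnorm_bounded i : lnorm_bounded (fun x => x i).
Proof.
have Lambda_bounded n : lnorm_bounded (fun x => Lambda lam x n).
  (* First difference: the sums are the [Lambda_sum x n], bounded with constant 1. *)
  apply: (@lnorm_bounded_summand (fun n x => Lambda lam x n)) => {}n.
  by exists 1 => x bx; rewrite mul1r; exact: Lambda_sum_le.
have diff_bounded n :
    lnorm_bounded (fun x => (lam n - lam_pred lam n)%:C%C * x n).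
  (* Second difference: multiplying [Lambda lam x n] by [lam n] leaves the plain sum of the weighted
     coordinates. *)
  apply: (@lnorm_bounded_summand
    (fun n x => (lam n - lam_pred lam n)%:C%C * x n)) => {}n.
  have [C nC] := lnorm_boundedZ (lam n)%:C%C _ (Lambda_bounded n).
  exists C => x bx; have := nC x bx; rewrite /Lambda mulrA -rmorphM.
  by rewrite mulfV ?mul1r// gt_eqF.
(* The weight is positive since [lam] increases strictly from [lam_pred lam 0 = 0], so it can be
   divided out. *)
have [C iC] := lnorm_boundedZ ((lam i - lam_pred lam i)^-1)%:C%C _ (diff_bounded i).
exists C => x bx; have := iC x bx; rewrite mulrA -rmorphM.
by rewrite mulVf ?mul1r// gt_eqF// lam_diff_gt0.
Qed.

Lemma lnorm0_eq0 x : bs_lambda lam x -> lnorm x = 0 -> x = 0.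
Proof.
move=> bx x0; apply/funext => i; have [C iC] := coord_lnorm_bounded i.
apply/rnorm0_eq0/eqP; rewrite eq_le rnorm_ge0 andbT.
by rewrite (le_trans (iC x bx))// x0 mulr0.
Qed.

(** * Completeness of subspaces closed under uniform limits of partial sums *)

Section Subspace.
Variable E : set (nat -> R[i]).
Hypothesis E_bs : E `<=` bs_lambda lam.
Hypothesis E_submod : submod_closed [pred x | x \in E].
(** This is closedness of [E] in [bs_lambda lam]: the inner bound amounts to
    [lnorm (x - y) <= e]. *)
Hypothesis E_closed : forall x, bs_lambda lam x ->
  (forall e : R, 0 < e -> exists2 y, E y &
     forall m, rnorm (Lambda_sum x m - Lambda_sum y m) <= e) -> E x.

(** Kept transparent so that the carrier and the norm compute to [E] and [lnorm]. *)
Definition lambda_seqspace : normed_seqspace R.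
Proof.
apply: (@NormedSeqspace R E lnorm) => //.
- by move=> x y /set_mem/E_bs bx /set_mem/E_bs; exact: lnormD.
- by move=> a x /set_mem/E_bs; exact: lnormZ.
- by move=> x /set_mem/E_bs; exact: lnorm0_eq0.
Defined.

Lemma lambda_seqspace_complete (u : nat -> seqspace lambda_seqspace) :
  rnorm_cauchy u -> exists l : seqspace lambda_seqspace, u @ \oo --> l.
Proof.
move=> uC.
have Eval (v : seqspace lambda_seqspace) : bs_lambda lam (val v).
  exact/E_bs/set_mem/(valP v).
have rnormB v w : rnorm (v - w : seqspace lambda_seqspace) = lnorm (val v - val w).
  by rewrite seqspace_rnormE raddfB.
(* By the coordinate bounds each coordinate of [u] is Cauchy; [l] collects the limits. *)
have /choice[l ul] : forall i, exists li : R[i], (fun n => val (u n) i) @ \oo --> li.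
  move=> i; apply: complex_complete => e e0; have [C iC] := coord_lnorm_bounded i.
  have C1 : 0 < `|C| + 1 by rewrite ltr_wpDl.
  have [N NP] := uC (e / (`|C| + 1)) (divr_gt0 e0 C1).
  exists N => m n Nm Nn; have := NP m n Nm Nn.
  rewrite ltr_pdivlMr//; apply: le_lt_trans.
  have := iC _ (Eval (u m - u n)); rewrite seqspace_rnormE raddfB => /le_trans; apply.
  rewrite mulrC ler_wpM2l//; last by rewrite (le_trans (ler_norm _))// lerDl.
  by apply: lnorm_ge0; have := Eval (u m - u n); rewrite raddfB.
(* [N] depends on [e] alone. The threshold [M], and with it [k], depends on [m], but [u k] is only
   an intermediate point and leaves no trace in the bound. *)
have unif e : 0 < e -> exists N, forall n, (N <= n)%N ->
    forall m, rnorm (Lambda_sum l m - Lambda_sum (val (u n)) m) <= e.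
  move=> e0; have e2 : 0 < e / 2 by rewrite divr_gt0.
  have [N NP] := uC _ e2; exists N => n Nn m.
  have /cvg_rnormP/(_ _ e2)[M MP] := Lambda_sum_cvg (fun k => val (u k)) l m ul.
  pose k := maxn N M.
  rewrite (le_trans (ler_rnorm_dist (Lambda_sum (val (u k)) m) _ _))//.
  rewrite (splitr e) lerD// ?ltW ?MP ?leq_maxr// -Lambda_sumB.
  rewrite (le_lt_trans _ (NP k n (leq_maxl _ _) Nn))// rnormB Lambda_sum_le//.
  by have := Eval (u k - u n); rewrite raddfB.
have bl : bs_lambda lam l.
  have [N /(_ N (leqnn _)) NP] := unif 1 ltr01.
  apply/bs_lambdaP; exists (1 + lnorm (val (u N))) => m.
  rewrite -(subrK (Lambda_sum (val (u N)) m) (Lambda_sum l m)).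
  by rewrite (le_trans (ler_rnormD _ _))// lerD ?Lambda_sum_le.
have El : l \in E.
  apply/mem_set/E_closed => // e e0; have [N NP] := unif e e0.
  by exists (val (u N)); [exact/set_mem/(valP (u N))|exact: NP].
exists (exist _ l El); apply/cvg_rnormP => e e0.
(* Halving [e] makes up for the non-strict inequality in [unif]. *)
have [|N NP] := unif (e / 2); first by rewrite divr_gt0.
exists N => n Nn; rewrite rnormB (@le_lt_trans _ _ (e / 2))//.
  by apply: lnorm_le => m; rewrite Lambda_sumB; exact: NP.
by rewrite ltr_pdivrMr// ltr_pMr// ltr1n.
Qed.

Lemma BK_space_lambda : BK_space_with_norm E (bs_lambda_norm lam).
Proof.
apply: (@BK_space_normed_seqspace R lambda_seqspace).
- by move=> x /set_mem/E_bs; exact: bs_lambda_normE.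
- move=> i; have [C iC] := coord_lnorm_bounded i.
  by exists C => x /set_mem/E_bs; exact: iC.
- exact: lambda_seqspace_complete.
Qed.

End Subspace.

(** * Inclusion, linearity and closedness for [cs_lambda] and [cs0_lambda] *)

Lemma cs_lambda_sub : cs_lambda lam `<=` bs_lambda lam.
Proof.
move=> x /cvg_rnorm_cauchy/(_ 1 ltr01)[N NP]; apply/bs_lambdaP.
(* The sum dominates each term up to [N]; later terms lie within 1 of the term at [N]. *)
exists (\sum_(k < N.+1) rnorm (Lambda_sum x k) + 1) => m.
have term_le k : (k <= N)%N ->
    rnorm (Lambda_sum x k) <= \sum_(k < N.+1) rnorm (Lambda_sum x k).
  rewrite -ltnS => kN; rewrite (bigD1 (Ordinal kN))//= lerDl sumr_ge0// => j _.
  exact: rnorm_ge0.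
have [/term_le mN|Nm] := leqP m N; first by rewrite ler_wpDr.
rewrite -(subrK (Lambda_sum x N) (Lambda_sum x m)) addrC.
by rewrite (le_trans (ler_rnormD _ _))// lerD ?term_le// ltW// NP// ltnW.
Qed.

Lemma cs_lambdaP x :
  cs_lambda lam x <-> exists l : R[i], Lambda_sum x @ \oo --> l.
Proof. exact: cvg_ex. Qed.

Lemma cs0_lambda_sub : cs0_lambda lam `<=` cs_lambda lam.
Proof. by move=> x x0; apply/cs_lambdaP; exists 0. Qed.

Lemma Lambda_sum_cvg_linear a x y (l l' : R[i]) :
  Lambda_sum x @ \oo --> l -> Lambda_sum y @ \oo --> l' ->
  Lambda_sum (a *: x + y) @ \oo --> a *: l + l'.
Proof.
move=> xl yl'; rewrite (_ : Lambda_sum _ = a \*: Lambda_sum x \+ Lambda_sum y).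
  exact: cvgD (cvgZr xl) yl'.
by apply/funext => m; exact: Lambda_sum_linear.
Qed.

Lemma Lambda_sum_cvg0 : Lambda_sum 0 @ \oo --> (0 : R[i]).
Proof.
by apply/cvg_rnormP => e e0; exists 0%N => n _; rewrite Lambda_sum0 subrr rnorm0.
Qed.

Lemma cs_lambda_submod : submod_closed [pred x | x \in cs_lambda lam].
Proof.
split=> [|a x y].
  by apply/mem_set/cs_lambdaP; exists 0; exact: Lambda_sum_cvg0.
move=> /set_mem/cs_lambdaP[l xl] /set_mem/cs_lambdaP[l' yl'].
apply/mem_set/cs_lambdaP; exists (a *: l + l').
exact: Lambda_sum_cvg_linear.
Qed.

Lemma cs0_lambda_submod : submod_closed [pred x | x \in cs0_lambda lam].
Proof.
split=> [|a x y]; first exact/mem_set/Lambda_sum_cvg0.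
move=> /set_mem x0 /set_mem y0; apply/mem_set.
by have := Lambda_sum_cvg_linear a _ _ _ _ x0 y0; rewrite scaler0 addr0.
Qed.

(** It suffices that the partial sums of [x] are Cauchy: passing to those of a nearby [y] costs
    [e / 4] at [m] and at [n], and the Cauchy condition for [y] costs [e / 2]. *)
Lemma cs_lambda_closed x :
  (forall e : R, 0 < e -> exists2 y, cs_lambda lam y &
     forall m, rnorm (Lambda_sum x m - Lambda_sum y m) <= e) -> cs_lambda lam x.
Proof.
move=> xE; apply/cs_lambdaP/complex_complete => e e0.
have e4 : 0 < e / 2 / 2 by rewrite !divr_gt0.
have [y /cvg_rnorm_cauchy yC xy] := xE _ e4.
have [|N NP] := yC (e / 2); first by rewrite divr_gt0.
exists N => m n Nm Nn.
apply: le_lt_trans (ler_rnorm_dist (Lambda_sum y m) _ _) _.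
rewrite (splitr e) [X in _ < X + _](splitr (e / 2)) -addrA ler_ltD ?xy//.
apply: le_lt_trans (ler_rnorm_dist (Lambda_sum y n) _ _) _.
by rewrite [ltLHS]addrC ler_ltD ?NP// rnorm_distC.
Qed.

Lemma cs0_lambda_closed x :
  (forall e : R, 0 < e -> exists2 y, cs0_lambda lam y &
     forall m, rnorm (Lambda_sum x m - Lambda_sum y m) <= e) -> cs0_lambda lam x.
Proof.
move=> xE; apply/cvg_rnormP => e e0.
have e2 : 0 < e / 2 by rewrite divr_gt0.
have [y /cvg_rnormP/(_ _ e2)[N NP] xy] := xE _ e2.
exists N => n Nn; apply: le_lt_trans (ler_rnorm_dist (Lambda_sum y n) _ _) _.
by rewrite (splitr e) ltr_leD ?NP// rnorm_distC; exact: xy.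
Qed.

End LambdaNorm.

Theorem theorem2p1 (R : realType) (lam : nat -> R)
    (lam_gt0 : forall k : nat, 0 < lam k)
    (lam_incr : forall m n : nat, (m < n)%N -> lam m < lam n)
    (lam_oo : lam @ \oo --> +oo) :
  [/\ BK_space_with_norm (cs_lambda lam) (bs_lambda_norm lam),
      BK_space_with_norm (cs0_lambda lam) (bs_lambda_norm lam) &
      BK_space_with_norm (bs_lambda lam) (bs_lambda_norm lam)].
Proof.
(* For [bs_lambda] inclusion and closedness are immediate, so only linearity remains there; the
   other two spaces leave three goals each. *)
split; apply: BK_space_lambda => //.
- exact: cs_lambda_sub.
- exact: cs_lambda_submod.
- by move=> x _; exact: cs_lambda_closed.
- by move=> x /cs0_lambda_sub/cs_lambda_sub.
- exact: cs0_lambda_submod.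
- by move=> x _; exact: cs0_lambda_closed.
- exact: bs_lambda_submod.
Qed.
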